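(* For every integer $n\ge1$ and every $0\le j\le\lfloor n/2\rfloor$, the toric $g$-contribution polynomial $$g_{n,j}(t)=\sum_{k=0}^{\lfloor n/2\rfloor}\mathrm{Cat}_{n-k-j}\binom{n-k}{k}(t-1)^k$$ is real-rooted.
   Context: $\mathrm{Cat}_r=\frac1{r+1}\binom{2r}{r}$ is the $r$th Catalan number. A polynomial is real-rooted if all its complex zeros are real (nonzero constants are real-rooted). *)

(* Defs.v *)
From mathcomp Require Import all_boot all_order all_algebra.
From mathcomp Require Import reals complex.

Set Implicit Arguments.
Unset Strict Implicit.
Unset Printing Implicit Defensive.

Import Order.TTheory GRing.Theory Num.Theory.
Local Open Scope ring_scope.

Definition catalan (R : realType) (r : nat) : R :=
  r.+1%:R^-1 * 'C(2 * r, r)%:R.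

(* For j <= n./2 and k <= n./2 no truncation occurs in the subtractions
   n - k and n - k - j. *)
Definition toric_g (R : realType) (n j : nat) : {poly R} :=
  \sum_(0 <= k < n./2.+1)
    (catalan R (n - k - j) * 'C(n - k, k)%:R) *: ('X - 1) ^+ k.

(* Nonzero constants satisfy this vacuously; the zero polynomial does not. *)
Definition real_rooted (R : realType) (p : {poly R}) : Prop :=
  forall z : R[i], root (map_poly (real_complex R) p) z -> z \is Num.real.

(* Main.v *)
(* Write u = t - 1 and u = -1/y^2. Up to constants, the u^k coefficient of the
   polynomial is C(N, k) (2n - 2j - 2k)^_(n - 2j) (n - k)^_(j - 1) for j > 0,
   where N = n - j: the first two factors are the coefficients of
   B = (d/dy)^(n - 2j) (1 - y^2)^N, which is real-rooted by Gauss-Lucas, and the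
   last one comes from differentiating j - 1 times, in s = y^2, the real-rooted
   polynomial y^n B(y).
   For j = 0 one has N = n + 1, no last factor, and
   B = (d/dy)^n q with q = (1 - (1 - y^2)^(n + 1)) / y^2. Here q has
   no real-rootedness to start from, but it agrees with y^-2 to order n at
   y = 1 and y = -1, so q^(l) and q^(l + 1) have opposite signs at 1 and equal
   signs at -1. This boundary behaviour yields one zero of q^(l + 1) beyond each
   extreme zero of q^(l), in addition to those given by Rolle, so that q^(n), of
   degree n, has n zeros in ]-1, 1[. *)
Require Import Defs.
From mathcomp Require Import all_boot all_order all_algebra.
From mathcomp Require Import reals complex.
From mathcomp Require Import polyrcf ring zify.
Set Implicit Arguments.
Unset Strict Implicit.
Unset Printing Implicit Defensive.

Import Order.TTheory GRing.Theory Num.Theory.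
Local Open Scope ring_scope.

(** * Real zeros under differentiation over a closed field (Gauss-Lucas) *)

Definition real_roots (C : numClosedFieldType) (p : {poly C}) : Prop :=
  forall z : C, root p z -> z \is Num.real.

Lemma Im_inv_lt0 (C : numClosedFieldType) (z : C) :
  'Im z != 0 -> 'Im z^-1 * 'Im z < 0.
Proof.
move=> Iz0; have z0 : z != 0 by apply: contraNneq Iz0 => ->; rewrite raddf0.
rewrite invC_norm ImMl ?rpredV ?rpredX ?normr_real // Im_conj mulrN mulNr.
rewrite oppr_lt0 -mulrA pmulr_rgt0 ?invr_gt0 ?exprn_gt0 ?normr_gt0 //.
by rewrite -expr2 real_exprn_even_gt0 ?Creal_Im.
Qed.

(** The logarithmic derivative is the sum of the [(z - a)^-1]. Each [a] is real, so every summand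
    has imaginary part of sign opposite to that of [z], and nothing cancels. *)
Lemma Im_logderiv_prod (C : numClosedFieldType) (rs : seq C) (z : C)
    (q := \prod_(a <- rs) ('X - a%:P)) :
  {subset rs <= Num.real} -> 'Im z != 0 ->
  q.[z] != 0 /\ (rs != [::] -> 'Im (q^`().[z] / q.[z]) * 'Im z < 0).
Proof.
move=> + Iz0; rewrite {}/q.
elim: rs => [|a rs IH] rs_real; first by rewrite big_nil hornerE oner_eq0.
have a_real : a \is Num.real by apply: rs_real; rewrite mem_head.
have [x x_rs|q0 qlt0] := IH; first by apply: rs_real; rewrite inE x_rs orbT.
have Iza : 'Im (z - a) = 'Im z by rewrite raddfB /= (Creal_ImP a a_real) subr0.
have za0 : z - a != 0 by apply: contraNneq Iz0 => za; rewrite -Iza za raddf0.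
have lt0 : 'Im (z - a)^-1 * 'Im z < 0 by have := @Im_inv_lt0 _ (z - a); rewrite Iza; apply.
rewrite big_cons derivM derivXsubC mul1r hornerD !hornerM hornerXsubC.
split=> [|_]; first by rewrite mulf_neq0.
have [->|/qlt0 {}qlt0] := eqVneq rs [::].
  by rewrite big_nil derivC !hornerC mulr0 addr0 mulr1 mul1r.
rewrite (_ : _ / _ = (z - a)^-1 + (\prod_(b <- rs) ('X - b%:P))^`().[z] /
    (\prod_(b <- rs) ('X - b%:P)).[z]); last by field; rewrite q0.
by rewrite raddfD mulrDl /= ltr_wnDl // ltW.
Qed.

(** The logarithmic derivative cannot vanish at a nonreal point. The size bound excludes constants,
    whose derivative is zero everywhere. *)
Lemma real_roots_deriv (C : numClosedFieldType) (p : {poly C}) :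
  (1 < size p)%N -> real_roots p -> real_roots p^`().
Proof.
have [rs ->] := closed_field_poly_normal p; set c := lead_coef p => sp rr z.
have c0 : c != 0 by apply: contraTneq sp => ->; rewrite scale0r size_poly0.
have rs0 : rs != [::].
  apply: contraTneq sp => ->; rewrite big_nil -leqNgt.
  exact: leq_trans (size_scale_leq _ _) (size_polyC_leq1 _).
have rs_real : {subset rs <= Num.real}.
  move=> x x_rs; apply: rr; rewrite rootZ //; first by rewrite root_prod_XsubC.
apply: contraTT => /Creal_ImP/eqP Iz0.
have [q0 /(_ rs0)] := Im_logderiv_prod rs_real Iz0.
rewrite derivZ rootZ // rootE; apply: contraTneq => ->.
by rewrite mul0r raddf0 mul0r ltxx.
Qed.

Lemma size_derivn (C : numDomainType) (p : {poly C}) r :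
  size p^`(r) = (size p - r)%N.
Proof.
elim: r => [|r IH]; first by rewrite subn0.
rewrite derivnS subnS -IH; set q := p^`(r).
have [->|q0] := eqVneq q 0; first by rewrite derivC size_poly0.
have sq : (0 < size q)%N by rewrite size_poly_gt0.
have [sq1|sq1] := leqP (size q) 1.
  by rewrite (size1_polyC sq1) derivC size_poly0 size_polyC; case: (_ == 0).
apply/eqP; rewrite eqn_leq -ltnS prednK // lt_size_deriv //=.
rewrite -(prednK (_ : 0 < (size q).-1)%N); last by rewrite -ltnS prednK.
rewrite ltnNge; apply/negP => /leq_sizeP/(_ _ (leqnn _)).
rewrite coef_deriv !prednK //; last by rewrite -ltnS prednK.
by move/eqP; rewrite mulrn_eq0 -lead_coefE lead_coef_eq0 (negPf q0); lia.
Qed.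

Lemma real_roots_derivn (C : numClosedFieldType) (p : {poly C}) r :
  (r < size p)%N -> real_roots p -> real_roots p^`(r).
Proof.
move=> + rr; elim: r => [|r IH] rp //; rewrite derivnS.
by apply: real_roots_deriv (IH _); rewrite ?size_derivn ?ltn_subRL ?addn1 // ltnW.
Qed.

(** * Counting zeros of derivatives in an interval from signs at its ends *)

Lemma deriv_root_right (R : rcfType) (p : {poly R}) a b :
  a < b -> root p a -> p.[b] * p^`().[b] < 0 ->
  exists2 c, c \in `]a, b[ & root p^`() c.
Proof.
move=> ab /rootP pa pb; have [c c_ab] := poly_mvt p ab.
rewrite pa subr0 => pbE.
have cb : c < b by rewrite (itvP c_ab).
have [|d d_ivt rd] := @poly_ivtoo _ p^`() c b (ltW cb).
  by move: pb; rewrite pbE mulrAC pmulr_llt0 ?subr_gt0.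
exists d => //; rewrite in_itv /= (itvP d_ivt) andbT.
by apply: lt_trans (_ : c < _); rewrite ?(itvP c_ab) ?(itvP d_ivt).
Qed.

(** Rolle serves the gaps between consecutive zeros of [a :: xs], and [deriv_root_right] the last
    gap, up to [b]. *)
Lemma deriv_roots_right (R : rcfType) (p : {poly R}) a b xs :
  root p a -> p.[b] * p^`().[b] < 0 ->
  path <%R a (rcons xs b) -> all (root p) xs ->
  exists ys, [/\ size ys = (size xs).+1, path <%R a (rcons ys b)
               & all (root p^`()) ys].
Proof.
move=> + pb; elim: xs a => [|x xs IH] a pa /=.
  rewrite andbT => /deriv_root_right/(_ pa pb)[c c_ab rc] _.
  by exists [:: c]; rewrite /= rc !(itvP c_ab).
move=> /andP[ax xs_path] /andP[px pxs].
have [ys [szys ys_path rys]] := IH x px xs_path pxs.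
have [|c c_ax rc] := @poly_rolle _ a x p ax; first by rewrite (rootP pa) (rootP px).
exists (c :: ys); split; rewrite /= ?szys //.
  rewrite (itvP c_ax); apply: path_le ys_path; first exact: lt_trans.
  by rewrite (itvP c_ax).
by rewrite rys andbT; apply/rootP.
Qed.

Lemma deriv_root_left (R : rcfType) (p : {poly R}) a b :
  a < b -> root p b -> 0 < p.[a] * p^`().[a] ->
  exists2 c, c \in `]a, b[ & root p^`() c.
Proof.
move=> ab /rootP pb pa; have [c c_ab] := poly_mvt p ab.
rewrite pb sub0r => pbE.
have ac : a < c by rewrite (itvP c_ab).
have [|d d_ivt rd] := @poly_ivtoo _ p^`() a c (ltW ac).
  move: pa; rewrite -[p.[a]]opprK pbE mulNr oppr_gt0 mulrAC pmulr_llt0 ?subr_gt0 //.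
  by rewrite mulrC.
exists d => //; rewrite in_itv /= (itvP d_ivt) ?andbT.
by apply: lt_trans (_ : _ < c) _; rewrite ?(itvP c_ab) ?(itvP d_ivt).
Qed.

(** Induction on [n]: for [n > 0], Rolle turns [n] zeros into [n - 1], and the signs at [a] and [b]
    add one zero on each side. *)
Lemma derivn_many_roots (R : rcfType) (q : {poly R}) a b n :
  a < b ->
  (forall l, (l <= n)%N -> 0 < q^`(l).[a]) ->
  (forall l, (l <= n)%N -> 0 < (-1) ^+ l * q^`(l).[b]) ->
  exists xs, [/\ size xs = n, path <%R a (rcons xs b) & all (root q^`(n)) xs].
Proof.
move=> ab qa qb; elim: n qa qb => [|n IH] qa qb.
  by exists [::]; rewrite /= ab.
have [l ln|l ln|xs [szxs xs_path rxs]] := IH.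
- exact/qa/leqW.
- exact/qb/leqW.
have qa' : 0 < q^`(n).[a] * q^`(n.+1).[a] by rewrite mulr_gt0 ?qa.
have qb' : q^`(n).[b] * q^`(n.+1).[b] < 0.
  have := mulr_gt0 (qb n (leqnSn n)) (qb n.+1 (leqnn _)).
  rewrite mulrACA exprS mulN1r mulrN -expr2 sqrr_sign mulN1r.
  by rewrite oppr_gt0.
rewrite derivnS in qa' qb' *.
case: xs szxs xs_path rxs => [|x xs] /= szxs.
  (* Here [n = 0] and there is no zero to start from; the first derivative itself changes sign
     between [a] and [b]. *)
  move=> _ _; move: qa' qb'; rewrite -szxs => qa' qb'.
  have [|c c_ab rc] := @poly_ivtoo _ q^`() a b (ltW ab).
    have := qa 1%N; have := qb 1%N; rewrite -szxs => /(_ isT) qb1 /(_ isT) qa1.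
    by move: qb1; rewrite expr1 mulN1r oppr_gt0 derivn1 => ?; rewrite pmulr_rlt0.
  by exists [:: c]; rewrite /= rc !(itvP c_ab).
move=> /andP[ax xs_path] /andP[rx rxs].
have [ys [szys ys_path rys]] := deriv_roots_right rx qb' xs_path rxs.
have [c c_ax rc] := deriv_root_left ax rx qa'.
exists (c :: ys); split; rewrite /= ?szys ?szxs ?rc //.
rewrite (itvP c_ax); apply: path_le ys_path; first exact: lt_trans.
by rewrite (itvP c_ax).
Qed.

(** With as many distinct zeros in [R] as its degree, [p] splits over [R]. *)
Lemma real_roots_of_sorted (R : rcfType) (p : {poly R}) xs :
  size p = (size xs).+1 -> sorted <%R xs -> all (root p) xs ->
  real_roots (map_poly (real_complex R) p).
Proof.
move=> szp xs_sorted rxs z.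
rewrite (all_roots_prod_XsubC szp rxs); last first.
  by rewrite uniq_rootsE; apply: sorted_uniq xs_sorted; [exact: lt_trans|exact: ltxx].
have p0 : lead_coef p != 0 by rewrite lead_coef_eq0 -size_poly_gt0 szp.
rewrite map_polyZ rootZ ?fmorph_eq0 // rmorph_prod /=.
under eq_bigr do rewrite map_polyXsubC.
rewrite -(big_map (real_complex R) predT (fun y => 'X - y%:P)) root_prod_XsubC.
by case/mapP=> x _ ->; by apply/complex_realP; exists x.
Qed.

(** * The polynomials [binX2] and the signs of their derivatives at 1 and -1 *)

Lemma derivn_comp_subX (R : comNzRingType) (p : {poly R}) (c : R) l :
  (p \Po (c%:P - 'X))^`(l) = (-1) ^+ l *: (p^`(l) \Po (c%:P - 'X)).
Proof.
elim: l => [|l IH]; first by rewrite scale1r.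
rewrite !derivnS IH derivZ deriv_comp derivB derivC derivX sub0r mulrN1.
by rewrite exprSr scalerN -scaleNr mulrN1.
Qed.

Lemma coef_mul1subX (R : nzRingType) (p : {poly R}) l :
  ((1 - 'X) * p)`_l = p`_l - (if l is m.+1 then p`_m else 0).
Proof. by rewrite mulrBl mul1r coefB coefXM; case: l. Qed.

(** Modulo ['X^n.+1], [p] is the power series of [(1 - 'X)^-2]. *)
Lemma coef_sqr_1subX_mul (R : nzRingType) (p : {poly R}) n :
  (forall l, (l <= n)%N -> ((1 - 'X) * ((1 - 'X) * p))`_l = (l == 0%N)%:R) ->
  forall l, (l <= n)%N -> p`_l = l.+1%:R.
Proof.
move=> pE.
have p1E l : (l <= n)%N -> ((1 - 'X) * p)`_l = 1.
  elim: l => [|l IH] ln; have := pE _ ln; rewrite coef_mul1subX ?subr0 //.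
  by rewrite IH ?(ltnW ln) // => /eqP; rewrite subr_eq0 => /eqP.
elim=> [|l IH] ln; have := p1E _ ln; rewrite coef_mul1subX ?subr0 //.
by rewrite IH ?(ltnW ln) // => /eqP; rewrite subr_eq nat1r => /eqP.
Qed.

(* The polynomial part of [(1 - X^2)^N / (- X^2)^(N - M)]; its derivative of
   order [M] is, for [N = M], a multiple of a Legendre polynomial. *)
Definition binX2 (R : nzRingType) (N M : nat) : {poly R} :=
  \sum_(k < M.+1) 'C(N, k)%:R *: (- 'X^2) ^+ (M - k).

Lemma binX2_diag (R : comNzRingType) M : binX2 R M M = (1 - 'X^2) ^+ M.
Proof.
by rewrite addrC exprDn; apply: eq_bigr => k _; rewrite expr1n mulr1 scaler_nat.
Qed.

Lemma sqrX_mul_binX2 (R : comNzRingType) n :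
  'X^2 * binX2 R n.+1 n = 1 - (1 - 'X^2) ^+ n.+1.
Proof.
rewrite -[(1 - 'X^2) ^+ _]binX2_diag {2}/binX2 big_ord_recr /= binn subnn.
rewrite scale1r opprD addrCA subrr addr0 mulr_sumr -sumrN.
apply: eq_bigr => k _; rewrite -scalerAr subSn ?leq_ord // [(- _) ^+ _.+1]exprS.
by rewrite mulNr scalerN opprK.
Qed.

Lemma size_binX2 (R : nzRingType) N M : (size (binX2 R N M) <= M.*2.+1)%N.
Proof.
apply: (leq_trans (size_sum _ _ _)); apply/bigmax_leqP => k _.
apply: (leq_trans (size_scale_leq _ _)).
rewrite exprNn -exprM -(rmorph_sign polyC) mul_polyC.
by apply: (leq_trans (size_scale_leq _ _)); rewrite size_polyXn ltnS -mul2n leq_mul2l leq_subr orbT.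
Qed.

(** After the substitution of [1 - 'X] for ['X], [q] agrees with [(1 - 'X)^-2] up to order [n], so
    the quantity equals [l.+1 * l!]. *)
Lemma derivn_binX2_at1 (R : realFieldType) n l :
  (l <= n)%N -> 0 < (-1) ^+ l * (binX2 R n.+1 n)^`(l).[1].
Proof.
move=> ln; set q := binX2 R n.+1 n.
have -> : (-1) ^+ l * q^`(l).[1] = (q \Po (1%:P - 'X))^`(l).[0].
  by rewrite derivn_comp_subX hornerZ horner_comp hornerD hornerN hornerX hornerC subr0.
rewrite horner_coef0 coef_derivn addn0 ffactnn.
rewrite (@coef_sqr_1subX_mul _ _ n) // => [|m mn].
  by rewrite pmulrn_lgt0 ?fact_gt0 ?ltr0n.
have := congr1 (comp_poly (1%:P - 'X)) (sqrX_mul_binX2 R n).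
rewrite rmorphM rmorphB !rmorphXn rmorphB !rmorphXn /= comp_polyX.
rewrite -/q -polyC1 comp_polyC polyC1 expr2 -mulrA => ->.
(* The factor ['X] makes the power of exponent [n.+1] invisible in coefficients of index at most
   [n]. *)
rewrite (_ : 1 - _ * _ = 'X * (1 + 1 - 'X)); last by ring.
by rewrite exprMn coefB coef1 coefXnM ltnS mn subr0.
Qed.

Lemma derivn_binX2_atN1 (R : realFieldType) n l :
  (l <= n)%N -> 0 < (binX2 R n.+1 n)^`(l).[-1].
Proof.
move=> ln; have := derivn_binX2_at1 R ln; congr (0 < _).
set q := binX2 R n.+1 n.
have q_even : q \Po (0%:P - 'X) = q.
  rewrite /q /binX2 raddf_sum; apply: eq_bigr => k _ /=.
  rewrite comp_polyZ rmorphXn rmorphN rmorphXn /= comp_polyX.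
  by rewrite sub0r sqrrN.
rewrite -{1}q_even derivn_comp_subX hornerZ horner_comp hornerD hornerN hornerX.
by rewrite hornerC sub0r mulrA -expr2 sqrr_sign mul1r.
Qed.

(** The degree is at most [2n - n = n], so the [n] zeros found in []-1, 1[] are all of them. *)
Lemma real_roots_derivn_binX2 (R : rcfType) n :
  real_roots (map_poly (real_complex R) (binX2 R n.+1 n)^`(n)).
Proof.
have [|l ln|l ln|xs [szxs xs_path rxs]] :=
  @derivn_many_roots _ (binX2 R n.+1 n) (-1) 1 n.
- by rewrite gtrN.
- exact: derivn_binX2_atN1.
- exact: derivn_binX2_at1.
have xs_sorted : sorted <%R xs.
  by move: xs_path; rewrite rcons_path => /andP[/path_sorted].
apply: (real_roots_of_sorted _ xs_sorted rxs); apply/eqP.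
rewrite eqn_leq max_poly_roots //; last first.
- by apply: sorted_uniq xs_sorted; [exact: lt_trans|exact: ltxx].
- apply: contraTneq (derivn_binX2_at1 R (leqnn n)) => ->.
  by rewrite horner0 mulr0 ltxx.
rewrite andbT size_derivn szxs leq_subLR.
by apply: (leq_trans (size_binX2 _ _ _)); rewrite -addnn addnS.
Qed.

(** * Coefficients of the differentiated [binX2], and the passage from y to u *)

Lemma derivn_binX2 (R : comNzRingType) N n j : (j <= n./2)%N ->
  (binX2 R N (n - j))^`(n - j.*2) = \sum_(k < n./2.+1)
    ((-1) ^+ (n - j - k) * ('C(N, k) * (n - j - k).*2 ^_ (n - j.*2))%:R)
      *: 'X^(n - k.*2).
Proof.
move=> jn; rewrite /binX2 (raddf_sum (derivn _)).
have nM : (n./2.+1 <= (n - j).+1)%N by lia.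
pose F k : {poly R} := ((-1) ^+ (n - j - k) *
  ('C(N, k) * (n - j - k).*2 ^_ (n - j.*2))%:R) *: 'X^(n - k.*2).
rewrite (big_ord_widen _ F nM) [RHS]big_mkcond /=; apply: eq_bigr => k _.
rewrite derivnZ exprNn -exprM -(rmorph_sign polyC) mul_polyC derivnZ derivnXn.
rewrite mul2n -scaler_nat !scalerA /F natrM.
(* For [k > n./2] the degree [2(n - j - k)] is below the order [n - 2j], and the term vanishes. *)
case: ltnP => kn; last by rewrite ffact_small ?mulr0 ?scale0r //; have := ltn_ord k; lia.
congr (_ *: 'X^_); last by lia.
by rewrite mulrA (mulrC _ (_ ^+ _)).
Qed.

(* If [z] is a root and [s = -1/z], then [d^i/ds^i] of [s^(n/2) B(sqrt s)]
   vanishes at [s]. *)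
Lemma real_roots_derivn_sqrt (C : numClosedFieldType) n i (d : nat -> C) :
  (i <= n - n./2)%N -> d 0%N != 0 ->
  real_roots (\sum_(k < n./2.+1) ((-1) ^+ k * d k) *: 'X^(n - k.*2)) ->
  forall z, \sum_(k < n./2.+1) d k * ((n - k) ^_ i)%:R * z ^+ k = 0 ->
  z \is Num.real.
Proof.
move=> i_le d0 rrB z Pz0.
have [->|z0] := eqVneq z 0; first exact: rpred0.
pose S := \sum_(k < n./2.+1) ((-1) ^+ k * d k) *: 'X^(n - k).
have rrS : real_roots S.
  (* With [w ^+ 2 = s], [S.[s]] is [w ^+ n] times the given polynomial at [w]; hence a nonzero [w]
     is one of its zeros, so it is real, and so is its square. *)
  move=> s rs; rewrite -(sqrtCK s); set w := sqrtC s.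
  have [->|w0] := eqVneq w 0; first by rewrite expr0n rpred0.
  apply/rpredX/rrB; move: rs; rewrite -(sqrtCK s) -/w /root.
  rewrite (_ : S.[_] = w ^+ n *
    (\sum_(k < n./2.+1) ((-1) ^+ k * d k) *: 'X^(n - k.*2)).[w]).
    by rewrite mulf_eq0 expf_eq0 (negPf w0) andbF.
  rewrite !horner_sum mulr_sumr; apply: eq_bigr => k _.
  rewrite !hornerZ !hornerXn mulrCA -exprD -exprM; congr (_ * _ ^+ _).
  by have := ltn_ord k; lia.
have szS : (i < size S)%N.
  (* Only the term [k = 0] has degree [n], and its coefficient is [d 0]. *)
  apply: (@leq_ltn_trans n); first by lia.
  rewrite ltnNge; apply/negP => /leq_sizeP/(_ _ (leqnn _)).
  rewrite coef_sum big_ord_recl big1 => [|k _].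
    by rewrite coefZ coefXn subn0 eqxx expr0 mul1r mulr1 addr0 => /eqP; apply/negP.
  by rewrite coefZ coefXn lift0; case: eqP; rewrite ?mulr0 //; have := ltn_ord k; lia.
suff: - z^-1 \is Num.real by rewrite rpredN rpredV.
apply: (real_roots_derivn szS rrS); rewrite /root.
(* The nonzero power of [- z] clears denominators and reverses the order of the coefficients. *)
suff: (S^`(i)).[- z^-1] * (- z) ^+ (n - i) = 0.
  by move/eqP; rewrite mulf_eq0 expf_eq0 oppr_eq0 (negPf z0) andbF orbF.
rewrite -[RHS]Pz0 /S (raddf_sum (derivn _)) horner_sum mulr_suml.
apply: eq_bigr => k _.
(* No truncation occurs, since [i <= n - n./2 <= n - k]. *)
have -> : (n - i = n - k - i + k)%N by have := ltn_ord k; lia.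
rewrite /= derivnZ derivnXn hornerZ hornerMn hornerXn exprD -mulr_natr.
move: (n - k - i)%N => a; have s_z : - z^-1 * - z = 1 by rewrite mulrNN mulVf.
have z_k : (-1) ^+ k * (- z) ^+ k = z ^+ k by rewrite -exprMn mulN1r opprK.
rewrite -z_k -[RHS]mul1r -(expr1n _ a) -s_z exprMn; ring.
Qed.

Lemma map_binX2 (R S : nzRingType) (f : {rmorphism R -> S}) N M :
  map_poly f (binX2 R N M) = binX2 S N M.
Proof.
rewrite rmorph_sum; apply: eq_bigr => k _ /=.
by rewrite map_polyZ rmorph_nat rmorphXn rmorphN /= map_polyXn.
Qed.

(** [(1 - 'X^2) ^+ M] has degree [2M] and no zeros other than 1 and -1, so Gauss-Lucas applies [r]
    times. *)
Lemma real_roots_legendre (C : numClosedFieldType) M r :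
  (r <= M.*2)%N -> real_roots (binX2 C M M)^`(r).
Proof.
move=> rM; have sz : size (1 - 'X^2 : {poly C}) = 3.
  by rewrite -size_polyN opprB size_XnsubC.
rewrite binX2_diag; apply: real_roots_derivn => [|z].
  rewrite -[X in (_ < X)%N]prednK ?size_exp ?sz ?mul2n //.
  by rewrite size_poly_gt0 expf_neq0 // -size_poly_gt0 sz.
rewrite /root horner_exp expf_eq0 => /andP[_].
by rewrite !hornerE subr_eq0 eq_sym sqrf_eq1 => /orP[]/eqP->; rewrite ?rpredN rpred1.
Qed.

(* Both sides equal [N! (2m)! (n-k)! / (m!^2 k! (n-2k)!)], [m = n - j - k]. *)
Lemma catalan_bin_fact n j k (m := (n - j - k)%N) (N := (n - j + (j == 0))%N) :
  (j <= n./2)%N -> (k <= n./2)%N ->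
  (N`! * ('C(2 * m, m) * 'C(n - k, k)) =
   m.+1 * ('C(N, k) * m.*2 ^_ (n - j.*2) * (n - k) ^_ j.-1))%N.
Proof.
move=> jn kn; rewrite mul2n.
have E1 : ('C(m.*2, m) * (m`! * m`!) = m.*2`!)%N.
  rewrite -(@bin_fact m.*2 m); last by lia.
  by congr (_ * (_ * _`!))%N; lia.
have E2 : ('C(n - k, k) * (k`! * (n - k.*2)`!) = (n - k)`!)%N.
  rewrite -(@bin_fact (n - k) k); last by lia.
  by congr (_ * (_ * _`!))%N; lia.
have E3 : ('C(N, k) * (k`! * (N - k)`!) = N`!)%N by apply: bin_fact; lia.
have E4 : (m.*2 ^_ (n - j.*2) * (n - k.*2)`! = m.*2`!)%N.
  rewrite -(@ffact_fact m.*2 (n - j.*2)); last by lia.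
  by congr (_ * _`!)%N; lia.
have E5 : ((n - k) ^_ j.-1 * (n - k - j.-1)`! = (n - k)`!)%N.
  by apply: ffact_fact; lia.
(* The two arguments on the left are [m] and [m.+1] for [j > 0], and [m.+1] and [m] for [j = 0],
   where [j.-1] is 0; the shift in [N] makes both cases agree. *)
have E6 : ((N - k)`! * (n - k - j.-1)`! = m`! * (m.+1 * m`!))%N.
  rewrite -factS; case: (posnP j) => [j0|j_gt0].
    by rewrite mulnC; congr (_`! * _`!)%N; lia.
  by congr (_`! * _`!)%N; lia.
have pos : (0 < m`! * m`! * k`! * (n - k.*2)`!)%N by rewrite !muln_gt0 !fact_gt0.
apply/eqP; rewrite -(eqn_pmul2r pos); apply/eqP.
transitivity (N`! * m.*2`! * (n - k)`!)%N; first by rewrite -E1 -E2; ring.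
rewrite -E3 -E4 -E5.
transitivity ('C(N, k) * k`! * m.*2 ^_ (n - j.*2) * (n - k.*2)`! *
   (n - k) ^_ j.-1 * ((N - k)`! * (n - k - j.-1)`!))%N; first by ring.
by rewrite E6; ring.
Qed.

Theorem corollary8p2 (R : realType) (n j : nat) (hn : (1 <= n)%N)
    (hj : (j <= n./2)%N) :
  real_rooted (toric_g R n j).
Proof.
move=> z; pose N := (n - j + (j == 0%N))%N.
pose d k : R[i] := ('C(N, k) * (n - j - k).*2 ^_ (n - j.*2))%:R.
have rrB : real_roots (binX2 R[i] N (n - j))^`(n - j.*2).
  rewrite /N; case: (posnP j) => [->|j_gt0].
    rewrite subn0 addn1 -(map_binX2 (real_complex R)) derivn_map.
    exact: real_roots_derivn_binX2.
  by rewrite addn0; apply: real_roots_legendre; lia.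
have d0 : d 0%N != 0.
  by rewrite pnatr_eq0 bin0 mul1n -lt0n ffact_gt0; lia.
rewrite derivn_binX2 // in rrB.
(* Scaling by [(-1) ^+ (n - j)] turns the signs [(-1) ^+ (n - j - k)] into [(-1) ^+ k]. *)
have {}rrB : real_roots (\sum_(k < n./2.+1) ((-1) ^+ k * d k) *: 'X^(n - k.*2)).
  move=> w rw; apply: rrB; move: rw; rewrite -(@rootZ _ _ ((-1) ^+ (n - j))) ?signr_eq0 //.
  rewrite scaler_sumr; congr root; apply: eq_bigr => k _.
  rewrite scalerA mulrA; congr (_ * _ *: _).
  have kM : (k <= n - j)%N by have := ltn_ord k; lia.
  by rewrite -{1}(subnK kM) exprD -mulrA -expr2 sqrr_sign mulr1.
have i_le : (j.-1 <= n - n./2)%N by lia.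
rewrite /root => /eqP gz0; rewrite -(subrK 1 z) rpredD ?rpred1 //.
apply: (real_roots_derivn_sqrt i_le d0 rrB).
suff -> : \sum_(k < n./2.+1) d k * ((n - k) ^_ j.-1)%:R * (z - 1) ^+ k =
    N`!%:R * (map_poly (real_complex R) (toric_g R n j)).[z].
  by rewrite gz0 mulr0.
rewrite /toric_g big_mkord rmorph_sum horner_sum mulr_sumr.
apply: eq_bigr => k _ /=.
rewrite map_polyZ hornerZ rmorphXn rmorphB rmorph1 /= map_polyX.
rewrite horner_exp hornerXsubC mulrA; congr (_ * _).
(* The factor [m.+1] in [catalan_bin_fact] cancels the denominator of the Catalan number. *)
rewrite subnAC /catalan !rmorphM fmorphV !rmorph_nat -!mulrA.
rewrite [RHS]mulrCA -!natrM catalan_bin_fact ?leq_ord //.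
by rewrite [in RHS]natrM mulKf ?pnatr_eq0.
Qed.
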